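(* Let $p_1$ and $p_2$ be supermodular functions on the partitions of a finite set $V$, and let $\gamma\in\mathbb{Z}_+$. There exists an edge set $F$ on $V$ of size $\gamma$ such that $e_F(\mathcal{P})\ge\max\{p_1(\mathcal{P}),p_2(\mathcal{P})\}$ for every partition $\mathcal{P}$ of $V$ if and only if (i) $0\ge\max\{p_1(\{V\}),p_2(\{V\})\}$, and (ii) $\gamma\ge\max\{p_1(\mathcal{P}),p_2(\mathcal{P})\}$ for every partition $\mathcal{P}$ of $V$.
   Context: An edge set on $V$ is a multiset of unordered pairs $uv$ of distinct vertices of $V$. For an edge set $F$ and a partition $\mathcal{P}$ of $V$, $e_F(\mathcal{P})$ is the number of edges of $F$ whose endpoints lie in different members of $\mathcal{P}$. For partitions $\mathcal{P}_1,\mathcal{P}_2$ of $V$: start from the family $\mathcal{P}_1\cup\mathcal{P}_2$ (with multiplicities) and repeatedly replace two properly intersecting members $X,Y$ ($X\cap Y,X\setminus Y,Y\setminus X$ all nonempty) by $X\cap Y$ and $X\cup Y$ until no such pair remains; the minimal members form the partition $\mathcal{P}_1\sqcap\mathcal{P}_2$ (possibly depending on choices) and the maximal members form $\mathcal{P}_1\sqcup\mathcal{P}_2$. A function $p$ on partitions of $V$ is supermodular if $p(\mathcal{P}_1)+p(\mathcal{P}_2)\le p(\mathcal{P}_1\sqcap\mathcal{P}_2)+p(\mathcal{P}_1\sqcup\mathcal{P}_2)$ for all partitions $\mathcal{P}_1,\mathcal{P}_2$ (and any outcome of the uncrossing).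
   Formalization: The functions p_1, p_2 are taken integer-valued (the claim fails for real values), V is nonempty, and γ = 0 is required when V has a single element, since then no edges exist and the claim fails for γ > 0. *)

(* Defs.v *)
From mathcomp Require Import all_boot all_order all_algebra.
From mathcomp Require Import finmap multiset.
From Stdlib Require Import Relation_Operators.

Set Implicit Arguments.
Unset Strict Implicit.
Unset Printing Implicit Defensive.

Local Open Scope mset_scope.

Section PartitionFunctions.

Variable V : finType.
Implicit Types (P Q R : {set {set V}}) (X Y : {set V}).
Implicit Types (F L G : {mset {set V}}).

(* The unordered pair uv is encoded as the two-element set [set u; v]. *)
Definition edge_set F : Prop := forall e, e \in F -> #|e| = 2.

Definition separated P (e : {set V}) : bool :=
  [exists u in e, exists v in e, pblock P u != pblock P v].

(* e_F(P), counted with the multiplicities of F *)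
Definition cross_edges F P : nat := count (separated P) F.

Definition properly_intersecting X Y : bool :=
  [&& X :&: Y != set0, X :\: Y != set0 & Y :\: X != set0].

Inductive uncross_step : {mset {set V}} -> {mset {set V}} -> Prop :=
  UncrossStep G X Y of properly_intersecting X Y :
    uncross_step ([mset X; Y] `+` G) ([mset X :&: Y; X :|: Y] `+` G).

Definition uncrossed L : Prop :=
  forall X Y, X \in L -> Y \in L -> ~~ properly_intersecting X Y.

Definition union_family P1 P2 : {mset {set V}} :=
  seq_mset (enum P1) `+` seq_mset (enum P2).

(* Uncrossing P1 and P2 can produce Q as the meet and R as the join: both are
   read off the same final family L.  A set of multiplicity 2 in L is both
   minimal and maximal, hence belongs to Q and to R. *)
Definition uncrossing_outcome P1 P2 Q R : Prop :=
  exists L : {mset {set V}},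
    [/\ clos_refl_trans _ uncross_step (union_family P1 P2) L,
        uncrossed L,
        Q = [set X | minset (fun Y => Y \in L) X] &
        R = [set X | maxset (fun Y => Y \in L) X]].

(* A function on the partitions of V is a function on {set {set V}} of which
   only the values at partitions of V matter. *)
Definition supermodular (p : {set {set V}} -> int) : Prop :=
  forall P1 P2 Q R, partition P1 [set: V] -> partition P2 [set: V] ->
    uncrossing_outcome P1 P2 Q R -> (p P1 + p P2 <= p Q + p R)%R.

End PartitionFunctions.

(* Main.v *)
Require Import Defs.
From mathcomp Require Import all_boot all_order all_algebra.
From mathcomp Require Import finmap multiset.
From mathcomp Require Import zify.
From Stdlib Require Import Relation_Operators.

Set Implicit Arguments.
Unset Strict Implicit.
Unset Printing Implicit Defensive.

Import Order.TTheory Num.Theory.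

Local Open Scope mset_scope.

(** Call a partition [P] tight for [p] if [p P = gamma].  Since [gamma] bounds
    [p] from above, both partitions resulting from uncrossing two tight ones
    are tight, and the join is coarser than both.  So all tight partitions
    refine a coarsest one, which is not [{V}] as soon as [gamma > 0].  The
    coarsest tight partitions of [p1] and of [p2] correspond to two proper
    equivalence relations, whose union cannot be [V * V]; an edge [uv] outside
    the union is separated by every tight partition.  Subtracting
    [e_{uv}] preserves supermodularity, because [e_{uv}] is submodular, so
    induction on [gamma] applies. *)

(** An element satisfying [b] but not [a] would make the second count larger. Below, this compares
    the members of a family passing through different vertices. *)
Lemma count_sub_eq (T : eqType) (a b : pred T) (s : seq T) :
  {in s, forall x, a x -> b x} -> count a s = count b s ->
  {in s, forall x, b x -> a x}.
Proof.
move=> sub_ab eq_ab x xs bx; apply: contraT => nax.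
have: 0 < count (predI (predC a) b) s.
  by rewrite -has_count; apply/hasP; exists x => //=; rewrite nax.
have := count_predC a (filter b s); rewrite !count_filter size_filter -eq_ab.
rewrite (@eq_in_count _ (predI a b) a); first by lia.
by move=> y ys /=; apply/andP/idP => [[]|ay] //; split=> //; apply: sub_ab.
Qed.

(** * Counts and sums over multisets *)

Section MsetSeq.

Variable K : choiceType.
Implicit Types (A B : {mset K}) (x : K).

Lemma perm_msetD A B : perm_eq (A `+` B) (A ++ B).
Proof. by apply/allP => x _ /=; rewrite count_cat !count_mem_mset msetE2. Qed.

Lemma count_msetD (a : pred K) A B : count a (A `+` B) = count a A + count a B.
Proof. by rewrite (permP (perm_msetD A B)) count_cat. Qed.

Lemma count_mset1 (a : pred K) x : count a [mset x] = a x.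
Proof. by rewrite enum_msetn /= addn0. Qed.

Lemma sum_msetD (f : K -> nat) A B :
  \sum_(x <- A `+` B) f x = \sum_(x <- A) f x + \sum_(x <- B) f x.
Proof. by rewrite (perm_big _ (perm_msetD A B)) big_cat. Qed.

Lemma sum_mset1 (f : K -> nat) x : \sum_(y <- [mset x]) f y = f x.
Proof. by rewrite enum_msetn big_seq1. Qed.

End MsetSeq.

(** If [g] agrees on [u] and [v], some [t] has a [g]-value different from theirs, and [f t] cannot
    equal both [f u] and [f v]. The new edge is chosen this way. *)
Lemma nonconstant_pair (T : Type) (A B : eqType) (f : T -> A) (g : T -> B) :
  (exists u v, f u != f v) -> (exists u v, g u != g v) ->
  exists u v, f u != f v /\ g u != g v.
Proof.
move=> [u [v fuv]] [w [z gwz]].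
have [guv|guv] := eqVneq (g u) (g v); last by exists u, v.
have [t gtu] : exists t, g t != g u.
  have [gwu|] := eqVneq (g w) (g u); last by exists w.
  by exists z; rewrite -gwu eq_sym.
have [ftu|ftu] := eqVneq (f t) (f u); last by exists t, u.
by exists t, v; rewrite ftu -guv.
Qed.

(** * Termination of uncrossing *)

Section Uncrossing.

Variable V : finType.
Implicit Types (P Q R : {set {set V}}) (X Y Z : {set V}) (L : {mset {set V}}).
Implicit Types (u v : V) (p : {set {set V}} -> int).

(** The two sizes keep their sum but move strictly apart, since both differences are nonempty; by
    convexity the sum of squares grows. *)
Lemma uncross_measure_lt L L' : uncross_step L L' ->
  \sum_(X <- L) #|X| ^ 2 < \sum_(X <- L') #|X| ^ 2.
Proof.
case=> G X Y /and3P[_ dXY dYX].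
rewrite !sum_msetD !sum_mset1 ltn_add2r.
move: dXY dYX; rewrite -!card_gt0.
have := cardsID Y X; have := cardsID X Y; have := cardsUI X Y.
rewrite [Y :&: X]setIC !expnS !expn0 !muln1; nia.
Qed.

Lemma size_uncross_step L L' : uncross_step L L' -> size L' = size L.
Proof. by case=> G X Y _; rewrite -!count_predT !count_msetD !count_mset1. Qed.

Lemma uncrossing_exists L :
  exists2 L', clos_refl_trans _ (@uncross_step V) L L' & uncrossed L'.
Proof.
(* Uncrossing keeps the number of members, so the sum of squares never exceeds [size L * #|V| ^ 2];
   the induction is on the remaining gap. *)
have [n] := ubnP (size L * #|V| ^ 2 - \sum_(X <- L) #|X| ^ 2).
elim: n L => // n IHn L leLn.
have [/allP uncL|] :=
    boolP (all (fun X => all (fun Y => ~~ properly_intersecting X Y) L) L).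
  exists L; first exact: rt_refl.
  by move=> X Y XL YL; apply: (allP (uncL X XL)).
case/allPn=> X XL /allPn[Y YL /negbNE pXY].
(* As [X] and [Y] are distinct, one occurrence of each in [L] suffices to split off
   [[mset X; Y]]. *)
have XneqY : X != Y.
  by apply: contraTneq pXY => ->; rewrite /properly_intersecting setDv eqxx andbF.
have eqL : L = [mset X; Y] `+` (L `\` [mset X; Y]).
  apply/msetP => Z; rewrite !msetE2 !msetnE subnKC //.
  move: XL YL; rewrite !in_mset.
  have [->|_] := eqVneq Z X; first by rewrite (negbTE XneqY) addn0.
  by have [->|_] := eqVneq Z Y.
have step : uncross_step L ([mset X :&: Y; X :|: Y] `+` (L `\` [mset X; Y])).
  by rewrite {1}eqL; constructor.
move: step; set L1 := (_ `+` _) => step.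
have [|L' L1L' uncL'] := IHn L1; last first.
  by exists L' => //; apply: rt_trans L1L'; apply: rt_step.
have ub : \sum_(Z <- L1) #|Z| ^ 2 <= size L * #|V| ^ 2.
  rewrite -(size_uncross_step step) -sum1_size big_distrl /=.
  by apply: leq_sum => Z _; rewrite mul1n leq_exp2r // max_card.
rewrite (size_uncross_step step).
have := uncross_measure_lt step; lia.
Qed.

(** * Double covers of [V] and what uncrossing preserves *)

Definition twofold L := set0 \notin L /\ forall v, count (fun X => v \in X) L = 2.

Lemma twofold_step L L' : uncross_step L L' -> twofold L -> twofold L'.
Proof.
case=> G X Y /and3P[iXY _ _] [L0 L2]; split.
  move: L0; rewrite !in_msetE /= !negb_or => /andP[/andP[X0 Y0] ->].
  rewrite eq_sym iXY andbT /=; apply: contraNneq X0 => /esym/eqP.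
  by rewrite setU_eq0 eq_sym => /andP[].
move=> v; rewrite -(L2 v) !count_msetD !count_mset1 !inE.
by case: (v \in X); case: (v \in Y).
Qed.

(** If [X] and [Y] both contain the pair, so do intersection and union; if only one does, the union
    still does. This is the source of the submodularity of [e_{uv}]. *)
Lemma count_pair_step u v L L' : uncross_step L L' ->
  count (fun X => (u \in X) && (v \in X)) L
    <= count (fun X => (u \in X) && (v \in X)) L'.
Proof.
case=> G X Y _; rewrite !count_msetD !count_mset1 leq_add2r !inE.
by case: (u \in X); case: (u \in Y); case: (v \in X); case: (v \in Y).
Qed.

Lemma count_union_family (a : pred {set V}) P1 P2 :
  count a (union_family P1 P2) = count a (enum P1) + count a (enum P2).
Proof. by rewrite count_msetD !(permP (perm_eq_seq_mset _)). Qed.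

Lemma mem_partition_pblock P v : partition P [set: V] -> v \in pblock P v.
Proof. by case/and3P=> /eqP cP _ _; rewrite mem_pblock cP inE. Qed.

Lemma partition_pblock P v : partition P [set: V] -> pblock P v \in P.
Proof. by case/and3P=> /eqP cP _ _; rewrite pblock_mem // cP inE. Qed.

Lemma partition_def_pblock P X v :
  partition P [set: V] -> X \in P -> v \in X -> pblock P v = X.
Proof. by case/and3P=> _ tP _; apply: def_pblock. Qed.

Lemma count_pair_partition P u v : partition P [set: V] ->
  count (fun X => (u \in X) && (v \in X)) (enum P) = (pblock P u == pblock P v).
Proof.
move=> pP.
rewrite (@eq_in_count _ _
  (fun X => (X == pblock P u) && (pblock P u == pblock P v))).
  have [_|_] := eqVneq (pblock P u) _.
    rewrite (@eq_count _ _ (pred1 (pblock P u))); last by move=> X; rewrite andbT.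
    by rewrite count_uniq_mem ?enum_uniq // mem_enum partition_pblock.
  by rewrite (@eq_count _ _ pred0) ?count_pred0 // => X; rewrite andbF.
move=> X; rewrite mem_enum => XP; apply/andP/andP=> [[uX vX]|[/eqP-> /eqP eq_uv]].
  by rewrite !(partition_def_pblock pP XP).
by split; last rewrite eq_uv; apply: mem_partition_pblock.
Qed.

Lemma count_mem_partition P v : partition P [set: V] ->
  count (fun X => v \in X) (enum P) = 1.
Proof.
move=> pP; have := count_pair_partition v v pP; rewrite eqxx /= => <-.
by apply: eq_count => X; rewrite andbb.
Qed.

Lemma twofold_union_family P1 P2 :
  partition P1 [set: V] -> partition P2 [set: V] -> twofold (union_family P1 P2).
Proof.
move=> pP1 pP2; split=> [|v]; last first.
  by rewrite count_union_family !count_mem_partition.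
rewrite in_msetD !(perm_mem (perm_eq_seq_mset _)) !mem_enum negb_or.
by case/and3P: pP1 => _ _ ->; case/and3P: pP2 => _ _ ->.
Qed.

Lemma uncrossed_nested L X Y v : uncrossed L -> X \in L -> Y \in L ->
  v \in X -> v \in Y -> (X \subset Y) || (Y \subset X).
Proof.
move=> uncL XL YL vX vY; have := uncL X Y XL YL.
rewrite !negb_and !negbK !finset.setD_eq0 => /orP[/eqP XY0|//].
by have := in_set0 v; rewrite -XY0 inE vX vY.
Qed.

(** * Minimal and maximal members of an uncrossed double cover *)

Section Outcome.

Variable L : {mset {set V}}.
Hypotheses (L2 : twofold L) (uncL : uncrossed L).

Let Q := [set X | minset (fun Y => Y \in L) X].
Let R := [set X | maxset (fun Y => Y \in L) X].

Lemma twofold_mem v : exists2 X, X \in L & v \in X.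
Proof.
have : has (fun X => v \in X) L by rewrite has_count L2.2.
by case/hasP=> X; exists X.
Qed.

(* A smallest member through [v] is minimal: every member through [v] contains
   it, so both members through a point [c] of it pass through [v]; hence no
   member lies strictly inside it. *)
Lemma minimal_members_partition : partition Q [set: V].
Proof.
apply/and3P; split; last first.
- rewrite inE; apply/negP => /minsetp; exact/negP/(L2.1).
- apply/trivIsetP => X Y; rewrite !inE => mX mY; apply: contraR.
  rewrite -setI_eq0 => /set0Pn[v /setIP[vX vY]].
  have [XL YL] := (minsetp mX, minsetp mY).
  case/orP: (uncrossed_nested uncL XL YL vX vY) => sXY.
    by rewrite (minsetinf mY XL sXY).
  by rewrite (minsetinf mX YL sXY).
rewrite eqEsubset subsetT; apply/subsetP => v _; apply/bigcupP.
have [X0 X0L vX0] := twofold_mem v.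
pose through := [pred X : {set V} | (X \in L) && (v \in X)].
have [|X /andP[XL vX] minX] := @arg_minnP _ X0 through (fun X => #|X|).
  exact/andP.
exists X => //; rewrite inE; apply/minsetP; split=> // C CL sCX.
have C0 : C != set0 by apply: contraNneq L2.1 => <-.
have [c cC] := set0Pn _ C0.
have sub_X Y : Y \in L -> v \in Y -> X \subset Y.
  move=> YL vY; case/orP: (uncrossed_nested uncL XL YL vX vY) => // sYX.
  by have/eqP-> : Y == X by rewrite eqEcard sYX minX //=; apply/andP.
apply/eqP; rewrite eqEsubset sCX sub_X //.
apply: (@count_sub_eq _ (fun Y => v \in Y) (fun Y => c \in Y) L) => //.
  by move=> Y YL vY; apply: subsetP (sub_X _ YL vY) _ (subsetP sCX _ cC).
by rewrite !L2.2.
Qed.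

Lemma maximal_members_partition : partition R [set: V].
Proof.
apply/and3P; split; last first.
- rewrite inE; apply/negP => /maxsetp; exact/negP/(L2.1).
- apply/trivIsetP => X Y; rewrite !inE => mX mY; apply: contraR.
  rewrite -setI_eq0 => /set0Pn[v /setIP[vX vY]].
  have [XL YL] := (maxsetp mX, maxsetp mY).
  case/orP: (uncrossed_nested uncL XL YL vX vY) => sXY.
    by rewrite (maxsetsup mX YL sXY).
  by rewrite (maxsetsup mY XL sXY).
rewrite eqEsubset subsetT; apply/subsetP => v _; apply/bigcupP.
have [X XL vX] := twofold_mem v.
have [Y mY sXY] := maxset_exists (P := fun Y => Y \in L) XL.
by exists Y; rewrite ?inE // (subsetP sXY).
Qed.

Lemma maximal_members_coarse u v X :
  X \in L -> u \in X -> v \in X -> pblock R u = pblock R v.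
Proof.
move=> XL uX vX.
have [Y mY sXY] := maxset_exists (P := fun Y => Y \in L) XL.
have YR : Y \in R by rewrite inE.
by rewrite !(partition_def_pblock maximal_members_partition YR) // (subsetP sXY).
Qed.

(** A member containing the pair lies in a maximal one, which accounts for one unit. If two members
    contain it, they are all the members through [u], so the minimal member at [u] also contains
    [v]. *)
Lemma count_pair_outcome u v :
  count (fun X => (u \in X) && (v \in X)) L
    <= (pblock Q u == pblock Q v) + (pblock R u == pblock R v).
Proof.
set n := count _ L.
have [->//|n_gt0] := posnP n.
have /hasP[X XL /andP[uX vX]] : has (fun X => (u \in X) && (v \in X)) L.
  by rewrite has_count.
rewrite (maximal_members_coarse XL uX vX) eqxx.
have n_le2 : n <= 2.
  by rewrite -(L2.2 u); apply: sub_count => Y /andP[].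
have [n2|] := eqVneq n 2; last by lia.
have pQ := minimal_members_partition.
have QL : pblock Q u \in L.
  by have := partition_pblock u pQ; rewrite inE => /minsetp.
rewrite n2 (partition_def_pblock (v := v) pQ (partition_pblock u pQ)) ?eqxx //.
have := @count_sub_eq _ (fun Y => (u \in Y) && (v \in Y)) (fun Y => u \in Y) L.
case/(_ _ _ _ QL (mem_partition_pblock u pQ))/andP => //.
- by move=> Y _ /andP[].
- by rewrite L2.2.
Qed.

End Outcome.

(** * Meet and join of two partitions *)

Lemma count_pair_steps u v L L' : clos_refl_trans _ (@uncross_step V) L L' ->
  count (fun X => (u \in X) && (v \in X)) L
    <= count (fun X => (u \in X) && (v \in X)) L'.
Proof.
by elim=> {L L'} [L L' /count_pair_step|//|L1 L2 L3 _ le12 _]; last exact: leq_trans.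
Qed.

Lemma twofold_steps L L' : clos_refl_trans _ (@uncross_step V) L L' ->
  twofold L -> twofold L'.
Proof. by elim=> {L L'} [L L' /twofold_step|//|L1 L2 L3 _ f12 _ f23 /f12]. Qed.

(** The left side counts the members of the initial family containing both vertices, and this count
    never drops during uncrossing. Complementing the indicators turns the inequality into
    submodularity of [e_{uv}]. *)
Lemma uncrossing_outcome_spec P1 P2 Q R :
    partition P1 [set: V] -> partition P2 [set: V] ->
    uncrossing_outcome P1 P2 Q R ->
  [/\ partition Q [set: V], partition R [set: V] &
      forall u v,
        (pblock P1 u == pblock P1 v) + (pblock P2 u == pblock P2 v)
          <= (pblock Q u == pblock Q v) + (pblock R u == pblock R v)].
Proof.
move=> pP1 pP2 [L [stepsL uncL -> ->]].
have L2 := twofold_steps stepsL (twofold_union_family pP1 pP2).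
split; [exact: minimal_members_partition|exact: maximal_members_partition|].
move=> u v; apply: leq_trans (count_pair_outcome L2 uncL u v).
by rewrite -!count_pair_partition // -count_union_family; apply: count_pair_steps.
Qed.

(** A common block of [u] and [v] is an initial member containing both; some final member then
    contains both, and lies in a maximal one. *)
Lemma uncrossing_join_coarse P1 P2 Q R :
    partition P1 [set: V] -> partition P2 [set: V] ->
    uncrossing_outcome P1 P2 Q R ->
  forall u v, (pblock P1 u == pblock P1 v) || (pblock P2 u == pblock P2 v) ->
    pblock R u = pblock R v.
Proof.
move=> pP1 pP2 [L [stepsL uncL _ ->]] u v eq_uv.
have L2 := twofold_steps stepsL (twofold_union_family pP1 pP2).
have /hasP[X XL /andP[uX vX]] : has (fun X => (u \in X) && (v \in X)) L.
  rewrite has_count; apply: leq_trans (count_pair_steps _ _ stepsL).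
  by rewrite count_union_family !count_pair_partition // addn_gt0 !lt0b.
exact: maximal_members_coarse XL uX vX.
Qed.

Lemma uncrossing_outcome_exists P1 P2 : exists Q R, uncrossing_outcome P1 P2 Q R.
Proof.
have [L stepsL uncL] := uncrossing_exists (union_family P1 P2).
by do 2!eexists; exists L; split.
Qed.

(** * Subtracting an edge *)

Lemma separated_pair P u v :
  separated P [set u; v] = (pblock P u != pblock P v).
Proof.
apply/exists_inP/idP => [[x + /exists_inP[y]]|neq_uv].
  rewrite !inE => /orP[]/eqP-> /orP[]/eqP->; rewrite ?eqxx //.
  by rewrite eq_sym.
exists u; first by rewrite !inE eqxx.
by apply/exists_inP; exists v; rewrite ?inE ?eqxx ?orbT.
Qed.

Lemma supermodular_sub_edge p u v : supermodular p ->
  supermodular (fun P => (p P - (separated P [set u; v])%:Z)%R).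
Proof.
move=> p_super P1 P2 Q R pP1 pP2 out.
have := p_super _ _ _ _ pP1 pP2 out.
have [_ _ /(_ u v)] := uncrossing_outcome_spec pP1 pP2 out.
rewrite !separated_pair.
by do 4!case: (_ == _) => /=; lia.
Qed.

(** * Tight partitions *)

Lemma partition_setT : 0 < #|V| -> partition [set [set: V]] [set: V].
Proof.
move=> V_gt0; apply/and3P; split; last by rewrite inE eq_sym -card_gt0 cardsT.
  by rewrite /cover big_set1.
exact: trivIset1.
Qed.

Lemma partition_nonconstant P : 0 < #|V| -> partition P [set: V] ->
  P != [set [set: V]] -> exists u v, pblock P u != pblock P v.
Proof.
move=> /card_gt0P[x _] pP nT.
suff /existsP[u neq_xu] : [exists u, pblock P x != pblock P u] by exists x, u.
apply: contraNT nT; rewrite negb_exists => /forallP const.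
have eqx y : pblock P y = pblock P x by have := const y; rewrite negbK => /eqP.
have eqT : pblock P x = [set: V].
  by apply/setP => y; rewrite inE -(eqx y); apply: mem_partition_pblock.
apply/eqP/setP => X; rewrite inE; apply/idP/eqP => [XP|->].
  have /set0Pn[y yX] : X != set0 by apply: contraTneq XP => ->; case/and3P: pP.
  by rewrite -(partition_def_pblock pP XP yX) eqx.
by rewrite -eqT partition_pblock.
Qed.

(* [f] maps each vertex to its class in the coarsest tight partition, which is
   the join of all of them, or to itself when no partition is tight. *)
Lemma tight_labelling p (c : int) :
    1 < #|V| -> supermodular p -> (p [set [set: V]] < c)%R ->
    (forall P, partition P [set: V] -> (p P <= c)%R) ->
  exists f : V -> {set V}, (exists u v, f u != f v) /\
    forall P, partition P [set: V] -> p P = c ->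
    forall u v, f u != f v -> pblock P u != pblock P v.
Proof.
move=> V_gt1 p_super pVc ubp.
pose tight : pred {set {set V}} := fun P => partition P [set: V] && (p P == c).
have [P0 tP0|no_tight] := pickP tight; last first.
  exists set1; split.
    have /card_gt1P[u [v [_ _ neq_uv]]] := V_gt1.
    by exists u, v; rewrite (inj_eq set1_inj).
  by move=> P pP pPc; have := no_tight P; rewrite /tight pP pPc eqxx.
(* [R] is a tight partition with the most pairs inside blocks. Its join with any tight [P] is tight
   and keeps these pairs together, so by maximality it joins no others. *)
pose sim P := [set w : V * V | pblock P w.1 == pblock P w.2].
have [R /andP[pR /eqP pRc] maxR] := @arg_maxnP _ P0 tight (fun P => #|sim P|) tP0.
exists (pblock R); split.
  apply: partition_nonconstant => //; first exact: ltnW.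
  by apply: contraTneq pVc => <-; rewrite pRc ltxx.
move=> P pP pPc u v; apply: contraNneq => eq_uv.
have [Q [S out]] := uncrossing_outcome_exists P R.
have [pQ pS _] := uncrossing_outcome_spec pP pR out.
have coarse := uncrossing_join_coarse pP pR out.
have tS : tight S.
  rewrite /tight pS /=; have := p_super _ _ _ _ pP pR out.
  by have := ubp _ pQ; have := ubp _ pS; rewrite pPc pRc; lia.
have eq_sim : sim R = sim S.
  apply/eqP; rewrite eqEcard; apply/andP; split; last exact: maxR.
  apply/subsetP => w.
  by rewrite !inE => eq_w; apply/eqP/coarse; rewrite eq_w orbT.
have : (u, v) \in sim S by rewrite inE; apply/eqP/coarse; rewrite eq_uv eqxx.
by rewrite -eq_sim inE.
Qed.

(** * Construction of the edge set *)

Lemma edge_set_exists p1 p2 (gamma : nat) :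
    0 < #|V| -> (#|V| = 1 -> gamma = 0) ->
    supermodular p1 -> supermodular p2 ->
    (p1 [set [set: V]] <= 0)%R -> (p2 [set [set: V]] <= 0)%R ->
    (forall P, partition P [set: V] -> (p1 P <= gamma%:Z)%R) ->
    (forall P, partition P [set: V] -> (p2 P <= gamma%:Z)%R) ->
  exists F : {mset {set V}}, [/\ edge_set F, size F = gamma &
    forall P, partition P [set: V] ->
      (p1 P <= (cross_edges F P)%:Z)%R /\ (p2 P <= (cross_edges F P)%:Z)%R].
Proof.
(* [p1] and [p2] are generalized because the induction hypothesis is applied to [p1 - e_{uv}] and
   [p2 - e_{uv}]. *)
move=> V_gt0; elim: gamma p1 p2 => [|gamma IH] p1 p2 V1 sup1 sup2 p1V p2V ub1 ub2.
  exists mset0; split; [by move=> e; rewrite in_mset0|exact: size_mset0|].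
  by move=> P pP; rewrite /cross_edges enum_mset0 ub1 // ub2.
have V_gt1 : 1 < #|V| by case: (#|V|) V1 V_gt0 => [|[|?]] // /(_ erefl).
have [|f [nf tight1]] := tight_labelling V_gt1 sup1 _ ub1.
  exact: le_lt_trans p1V _.
have [|g [ng tight2]] := tight_labelling V_gt1 sup2 _ ub2.
  exact: le_lt_trans p2V _.
have [u [v [fuv guv]]] := nonconstant_pair nf ng.
(* Tight partitions lose one because they separate [u] from [v]; by integrality all others are
   already at most [gamma]. *)
have ub_sub p : (forall P, partition P [set: V] -> (p P <= gamma.+1%:Z)%R) ->
    (forall P, partition P [set: V] -> p P = Posz gamma.+1 ->
       pblock P u != pblock P v) ->
    forall P, partition P [set: V] ->
      (p P - (separated P [set u; v])%:Z <= gamma%:Z)%R.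
  move=> ub tight P pP; rewrite separated_pair; have := ub P pP.
  by have [/tight-> //|] := eqVneq (p P) (Posz gamma.+1); lia.
have [|||||F [F2 sF cF]] := IH _ _ _ (supermodular_sub_edge u v sup1)
    (supermodular_sub_edge u v sup2).
- by move=> V1'; rewrite V1' in V_gt1.
- by lia.
- by lia.
- by apply: ub_sub => // P pP /tight1; apply.
- by apply: ub_sub => // P pP /tight2; apply.
exists ([set u; v] +` F); split.
- move=> e; rewrite in_mset1D => /orP[/eqP->|/F2//].
  have neq_uv : u != v by apply: contraNneq fuv => ->.
  by rewrite cards2 neq_uv.
- by rewrite -sF -!count_predT count_msetD count_mset1.
move=> P pP; have [/= le1 le2] := cF P pP.
by rewrite /cross_edges count_msetD count_mset1 -/(cross_edges F P); split; lia.
Qed.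

Lemma cross_edges_setT F : cross_edges F [set [set: V]] = 0.
Proof.
rewrite /cross_edges (@eq_count _ _ pred0) ?count_pred0 // => e.
apply/exists_inP => -[u _ /exists_inP[v _]].
by rewrite !(@def_pblock _ _ setT) ?trivIset1 ?set11 ?inE ?eqxx.
Qed.

End Uncrossing.

(** The hypotheses on [#|V|] settle degenerate cases: for empty [V], [[set [set: V]]] contains the
    empty set and is no partition; on one vertex there are no edges, so [gamma] must be 0. *)
Theorem theorem1 (V : finType) (p1 p2 : {set {set V}} -> int) (gamma : nat)
    (V_gt0 : 0 < #|V|)
    (gamma_V1 : #|V| = 1 -> gamma = 0)
    (p1_super : supermodular p1) (p2_super : supermodular p2) :
  (exists F : {mset {set V}},
     [/\ edge_set F, size F = gamma &
         forall P : {set {set V}}, partition P [set: V] ->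
           (Num.max (p1 P) (p2 P) <= (cross_edges F P)%:Z)%R])
  <->
  ((Num.max (p1 [set [set: V]]) (p2 [set [set: V]]) <= 0)%R /\
   (forall P : {set {set V}}, partition P [set: V] ->
      (Num.max (p1 P) (p2 P) <= gamma%:Z)%R)).
Proof.
split=> [[F [_ sF cF]]|[pV ub]].
  (* Necessity: no edge crosses [{V}], and at most all [gamma] edges cross any partition. *)
  split=> [|P pP].
    by have := cF _ (partition_setT V_gt0); rewrite cross_edges_setT.
  by apply: le_trans (cF P pP) _; rewrite lez_nat -sF count_size.
move: pV; rewrite ge_max => /andP[p1V p2V].
have [||F [F2 sF cF]] := edge_set_exists V_gt0 gamma_V1 p1_super p2_super p1V p2V.
- by move=> P /ub; rewrite ge_max => /andP[].
- by move=> P /ub; rewrite ge_max => /andP[].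
by exists F; split=> // P /cF[le1 le2]; rewrite ge_max le1 le2.
Qed.
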